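(* Let $f_{0}\in\mathcal{D}_{+}^{2}$ with potential $U_{0}=U_{f_{0}}$ continuous on $(0,1)$, let $f_{t}$ solve the canonical flow $\partial_{t}f=(2\sin^{2}(\pi F)-1)f$, and let $U_{t}=U_{f_{t}}$ and $V(z)=\tan(\pi(z-\tfrac12))$. Then for every compact $K\subset(0,1)$ there is a function $\delta_{K}(t)\to0$ as $t\to\infty$ with $$\sup_{z\in K}\big|U_{t}(z)-2\pi^{2}\big|\ \le\ e^{-2t}\,\sup_{z\in K}\big(1+V(z)^{2}\big)^{2}\,\sup_{|s-\frac12|\le\delta_{K}(t)}\big|U_{0}(s)-2\pi^{2}\big|.$$ In particular $U_{t}\to2\pi^{2}$ locally uniformly on $(0,1)$, at the exact exponential rate $e^{-2t}$ provided $U_{0}(\tfrac12)\neq2\pi^{2}$, and at rate $o(e^{-2t})$ in the degenerate case $U_{0}(\tfrac12)=2\pi^{2}$, with asymptotic profile $$e^{2t}\big(U_{t}(z)-2\pi^{2}\big)\longrightarrow\big(1+V(z)^{2}\big)^{2}\big(U_{0}(\tfrac12)-2\pi^{2}\big)\qquad(t\to\infty)$$ whenever $U_{0}$ is continuous at $\tfrac12$. Equivalently, in curvature form: along the canonical flow the projective curvature of every such law, read at rank $z$, relaxes locally uniformly in rank to the Cauchy value $-2\pi^{2}$ at rate $e^{-2t}$, the initial law entering the limit only through the single number $U_{0}(\tfrac12)-2\pi^{2}$ in the profile above.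
   Context: $\mathcal{D}_{+}^{2}$ is the set of probability densities on $\mathbb{R}$ that are strictly positive and $C^{2}$ on an open interval and vanish outside it. $F$ denotes the distribution function of the current density; the canonical flow is globally well posed. For $f\in\mathcal{D}_{+}^{2}$ with quantile function $Q_{f}=F_{f}^{-1}$ on $(0,1)$, the rank Hill potential is the Schwarzian derivative $U_{f}(z)=\{Q_{f},z\}=\frac{Q_f'''}{Q_f'}-\frac32\big(\frac{Q_f''}{Q_f'}\big)^{2}$. The projective curvature is $R_{f}(x)=\{F_{f},x\}/f(x)^{2}$, and $R_{f}(x)=-U_{f}(F_{f}(x))$. *)

(* Defs.v *)
(* MathComp-Analysis. *)
From mathcomp Require Import all_boot all_order all_algebra.
From mathcomp Require Import all_classical all_reals all_analysis.

Set Implicit Arguments.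
Unset Strict Implicit.
Unset Printing Implicit Defensive.

Import Order.TTheory GRing.Theory Num.Theory.
Import numFieldNormedType.Exports.

Local Open Scope ring_scope.
Local Open Scope classical_set_scope.

Definition probability_density (R : realType) (f : R -> R) : Prop :=
  [/\ measurable_fun setT f,
      forall x, 0 <= f x
    & (\int[lebesgue_measure]_x (f x)%:E = 1)%E].

(* The interval may be unbounded; it is nonempty since f integrates to 1. *)
Definition D2plus (R : realType) (f : R -> R) : Prop :=
  probability_density f /\
  exists I : set R,
    [/\ open I, is_interval I,
        forall x, I x -> 0 < f x,
        forall x, ~ I x -> f x = 0
      & forall x, I x ->
          [/\ derivable f x 1, derivable f^`() x 1
            & {for x, continuous f^`(2)}] ].

Definition distr (R : realType) (f : R -> R) (x : R) : R :=
  \int[lebesgue_measure]_(y in `]-oo, x]) f y.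

(* The inverse of the distribution function, meaningful at z in (0, 1): for f
   in D2plus such a z has exactly one preimage, which xget selects; elsewhere
   the value is irrelevant. *)
Definition quantile (R : realType) (f : R -> R) (z : R) : R :=
  xget 0 [set x | distr f x = z].

Definition schwarzian (R : realType) (g : R -> R) (x : R) : R :=
  g^`(3)%classic x / g^`()%classic x
  - 3 / 2 * (g^`(2)%classic x / g^`()%classic x) ^+ 2.

Definition hill_potential (R : realType) (f : R -> R) : R -> R :=
  schwarzian (quantile f).

Definition projective_curvature (R : realType) (f : R -> R) (x : R) : R :=
  schwarzian (distr f) x / f x ^+ 2.

(* Classical solutions on [0, +oo): the values f t at t < 0 play no role, and
   the f t with t > 0 are only asked to be probability densities. *)
Definition canonical_flow (R : realType) (f0 : R -> R) (f : R -> R -> R)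
    : Prop :=
  [/\ f 0 = f0,
      forall t : R, 0 <= t -> probability_density (f t),
      forall x, {within `[0, +oo[, continuous (fun t => f t x)}
    & forall t x : R, 0 < t ->
        is_derive t 1 (fun s => f s x)
          ((2 * sin (pi * distr (f t) x) ^+ 2 - 1) * f t x)].

Definition cauchy_quantile (R : realType) (z : R) : R :=
  tan (pi * (z - 2^-1)).

(* W t tends to the constant w locally uniformly on (0, 1) as t -> +oo: exactly
   at the rate exp (- 2 t) if d <> 0, and at the rate o(exp (- 2 t)) if d = 0. *)
Definition relaxes (R : realType) (W : R -> R -> R) (w d : R) : Prop :=
  forall K : set R, compact K -> K `<=` `]0, 1[ ->
    [/\ {uniform K, W @ +oo --> (fun=> w)},
        d != 0 -> exists c C : R, [/\ 0 < c, 0 < C &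
          \forall t \near +oo, forall z, K z ->
            c * expR (- (2 * t)) <= `|W t z - w| <= C * expR (- (2 * t))]
      & d = 0 ->
        {uniform K, (fun t z => expR (2 * t) * (W t z - w)) @ +oo -->
          (fun=> 0)}].

Definition has_profile (R : realType) (W : R -> R -> R) (w : R) (p : R -> R)
    : Prop :=
  forall K : set R, compact K -> K `<=` `]0, 1[ ->
    {uniform K, (fun t z => expR (2 * t) * (W t z - w)) @ +oo --> p}.

(* Main.v *)
Require Import Defs.
From mathcomp Require Import all_boot all_order all_algebra.
From mathcomp Require Import all_classical all_reals all_analysis.
From mathcomp Require Import measurable_realfun ring lra.
Import Order.TTheory GRing.Theory Num.Theory.
Import numFieldNormedType.Exports.
Local Open Scope classical_set_scope.
Local Open Scope ring_scope.

Set Implicit Arguments.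
Unset Strict Implicit.
Unset Printing Implicit Defensive.

(** Write V for the Cauchy quantile.  In the coordinate y = V(F(x)) the
    canonical flow is linear.  Indeed, integrating
    d f_t / dt = - cos (2 pi F_t) f_t in x gives
    d F_t / dt = - sin (2 pi F_t) / (2 pi), that is d V(F_t) / dt = V(F_t), so
    that F_t = phi_t(F_0) where phi_t is the dilation V(phi_t(u)) = e^t V(u) of
    (0, 1) ([dilate]), and Q_t = Q_0 o phi_{-t}.

    The Schwarzian chain rule ([schwarzian_comp]) turns this into a formula
    for the potential.  As {V, z} = 2 pi^2 and scalings do not change a
    Schwarzian, V o phi_s = e^s V yields {phi_s, z} = 2 pi^2 - 2 pi^2 phi_s'^2
    ([schwarzian_dilate]), whence, with a = e^{-t},
      U_t(z) - 2 pi^2 = phi_{-t}'(z)^2 (U_0(phi_{-t}(z)) - 2 pi^2),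
      phi_{-t}'(z) = a (1 + V(z)^2) / (1 + a^2 V(z)^2)
    ([hill_potential_flow]).  On a compact set of ranks V is bounded, so
    phi_{-t}(z) tends to 1/2 uniformly; the bound, the profile and the rates
    can be read off the formula.  Since F_t inverts Q_t, the curvature read at
    rank z is - U_t(z) ([projective_curvature_flow]), and inherits everything.

    Integrating the flow equation in x would need differentiation under the
    integral sign and a change of variables for densities that are only known
    to be measurable.  Uniqueness avoids both: the explicit density
    f_0 phi_t'(F_0) has distribution function phi_t(F_0) on the support of f_0
    ([distr_dilated]) and solves the flow equation there.  If the distribution
    functions of f_t and of the explicit density differ by at most
    M e^{16 pi t}, the logarithms of the densities differ by at most
    (M / 4) e^{16 pi t} (mean value theorem in t), and integrating
    |a - b| <= |ln a - ln b| (a + b) over x, with total mass at most 2, brings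
    the bound down to (M / 2) e^{16 pi t} ([flow_gap_contract]).  Iterating,
    the two distribution functions coincide ([flow_distr]). *)

Local Notation mu := lebesgue_measure.

(** * Third-order jets and the Schwarzian derivative *)

Lemma is_derive1V (R : realType) (f : R -> R) (x a : R) :
  f x != 0 -> is_derive x 1 f a ->
  is_derive x 1 (fun y => (f y)^-1) (- a / f x ^+ 2).
Proof.
move=> f0 df; apply: is_derive_eq (is_deriveV f0 df) _.
by rewrite /GRing.scale /= !mulNr mulrC.
Qed.

Lemma is_derive_eq_on (R : realType) (D : set R) (g h : R -> R) (x l : R) :
  open D -> D x -> (forall y, D y -> g y = h y) ->
  is_derive x 1 g l -> is_derive x 1 h l.
Proof.
move=> Do Dx gh; apply: near_eq_is_derive.
by have /= := open_nbhs_nbhs (conj Do Dx); apply: filterS => y /gh.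
Qed.

(** Three successive derivatives on a set, given by explicit functions.
    Keeping them explicit lets them be composed and inverted by formulas, while
    iterated [derive1] only knows pointwise values. *)
Definition jet3 (R : realType) (D : set R) (g g1 g2 g3 : R -> R) : Prop :=
  forall x, D x ->
    [/\ is_derive x 1 g (g1 x), is_derive x 1 g1 (g2 x)
      & is_derive x 1 g2 (g3 x)].

(** Replacing also the first derivative is what allows a closed form
    of it to be substituted for the one that the chain rule produces. *)
Lemma jet3_eq_on (R : realType) (D : set R) (g h g1 h1 g2 g3 : R -> R) :
  open D -> (forall y, D y -> g y = h y) -> (forall y, D y -> g1 y = h1 y) ->
  jet3 D g g1 g2 g3 -> jet3 D h h1 g2 g3.
Proof.
move=> Do gh gh1 gJ x Dx; have [d0 d1 d2] := gJ x Dx.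
split=> //; last exact: is_derive_eq_on Do Dx gh1 d1.
by rewrite -gh1//; exact: is_derive_eq_on Do Dx gh d0.
Qed.

Lemma schwarzian_jet3 (R : realType) (D : set R) (g g1 g2 g3 : R -> R) x :
  open D -> jet3 D g g1 g2 g3 -> D x ->
  schwarzian g x = g3 x / g1 x - 3 / 2 * (g2 x / g1 x) ^+ 2.
Proof.
move=> Do gJ Dx.
have e1 y : D y -> g1 y = g^`()%classic y.
  by move=> /gJ[d _ _]; rewrite derive1E derive_val.
have e2 y : D y -> g2 y = g^`(2)%classic y.
  move=> Dy; have [_ d _] := gJ _ Dy.
  have d' := is_derive_eq_on Do Dy e1 d.
  by rewrite derive1nS /= derive1E derive_val.
have e3 : g3 x = g^`(3)%classic x.
  have [_ _ d] := gJ _ Dx.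
  have d' := is_derive_eq_on Do Dx e2 d.
  by rewrite derive1nS derive1E derive_val.
by rewrite /schwarzian -e1// -e2// -e3.
Qed.

Lemma schwarzian_eq_on (R : realType) (D : set R) (g h g1 g2 g3 : R -> R)
    (x : R) :
  open D -> (forall y, D y -> g y = h y) -> jet3 D g g1 g2 g3 -> D x ->
  schwarzian h x = schwarzian g x.
Proof.
move=> Do gh gJ Dx; rewrite (schwarzian_jet3 Do gJ)//.
by rewrite (schwarzian_jet3 Do (jet3_eq_on Do gh (fun _ _ => erefl) gJ)).
Qed.

Lemma jet3Z (R : realType) (D : set R) (c : R) (g g1 g2 g3 : R -> R) :
  jet3 D g g1 g2 g3 ->
  jet3 D (fun x => c * g x) (fun x => c * g1 x) (fun x => c * g2 x)
    (fun x => c * g3 x).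
Proof. by move=> gJ x /gJ[d0 d1 d2]; split; exact: is_deriveZ. Qed.

Lemma schwarzianZ (R : realType) (D : set R) (c : R) (g g1 g2 g3 : R -> R) x :
  open D -> jet3 D g g1 g2 g3 -> D x -> c != 0 -> g1 x != 0 ->
  schwarzian (fun x => c * g x) x = schwarzian g x.
Proof.
move=> Do gJ Dx c0 g10.
rewrite (schwarzian_jet3 Do (jet3Z c gJ))// (schwarzian_jet3 Do gJ)//.
by field; rewrite c0 g10.
Qed.

Lemma jet3_comp (R : realType) (D E : set R)
    (k k1 k2 k3 g g1 g2 g3 : R -> R) :
  (forall x, D x -> E (k x)) -> jet3 D k k1 k2 k3 -> jet3 E g g1 g2 g3 ->
  jet3 D (g \o k) (fun x => g1 (k x) * k1 x)
    (fun x => g2 (k x) * k1 x ^+ 2 + g1 (k x) * k2 x)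
    (fun x => g3 (k x) * k1 x ^+ 3 + 3 * (g2 (k x) * k1 x * k2 x)
              + g1 (k x) * k3 x).
Proof.
move=> kDE kJ gJ x Dx.
have [a0 a1 a2] := kJ x Dx; have [b0 b1 b2] := gJ _ (kDE _ Dx).
have c0 := is_derive1_comp b0 a0.
have c1 := is_derive1_comp b1 a0.
have c2 := is_derive1_comp b2 a0.
split=> //.
- apply: is_derive_eq (is_deriveM c1 a1) _ => /=.
  by rewrite /GRing.scale /=; ring.
- apply: is_derive_eq (is_deriveD (is_deriveM c2 (is_deriveX 2 a1))
    (is_deriveM c1 a2)) _ => /=.
  rewrite /GRing.scale /=. rewrite exprfctE; ring.
Qed.

(** The cocycle property of the Schwarzian derivative. *)
Lemma schwarzian_comp (R : realType) (D E : set R)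
    (k k1 k2 k3 g g1 g2 g3 : R -> R) (x : R) :
  open D -> open E -> (forall x, D x -> E (k x)) ->
  jet3 D k k1 k2 k3 -> jet3 E g g1 g2 g3 ->
  D x -> k1 x != 0 -> g1 (k x) != 0 ->
  schwarzian (g \o k) x = schwarzian g (k x) * k1 x ^+ 2 + schwarzian k x.
Proof.
move=> Do Eo kDE kJ gJ Dx k10 g10.
rewrite (schwarzian_jet3 Do (jet3_comp kDE kJ gJ))//.
rewrite (schwarzian_jet3 Do kJ)// (schwarzian_jet3 Eo gJ); last exact: kDE.
by field; rewrite k10 g10.
Qed.

Lemma is_derive_inverse_on (R : realType) (D E : set R) (F Q : R -> R)
    (z l : R) :
  open D -> open E -> D z -> (forall z, D z -> E (Q z)) ->
  (forall z, D z -> F (Q z) = z) ->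
  (forall x, E x -> Q (F x) = x) ->
  (forall x, E x -> {for x, continuous F}) ->
  is_derive (Q z) 1 F l -> l != 0 -> is_derive z 1 Q l^-1.
Proof.
move=> Do Eo Dz QE FK QK cF dF l0.
rewrite -{1}(FK z Dz); apply: is_derive_inverse dF l0.
  have /= := open_nbhs_nbhs (conj Eo (QE _ Dz)).
  by apply: filterS => x /QK.
have /= := open_nbhs_nbhs (conj Eo (QE _ Dz)).
by apply: filterS => x /cF.
Qed.

(** Faa di Bruno for an inverse: differentiate 1 / F'(Q) twice, using
    Q' = 1 / F'(Q) each time. *)
Lemma jet3_inverse (R : realType) (D E : set R) (F Q f1 f2 f3 : R -> R) :
  open D -> open E -> (forall z, D z -> E (Q z)) ->
  (forall z, D z -> F (Q z) = z) -> (forall x, E x -> Q (F x) = x) ->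
  jet3 E F f1 f2 f3 -> (forall x, E x -> f1 x != 0) ->
  jet3 D Q (fun z => (f1 (Q z))^-1)
    (fun z => - f2 (Q z) / f1 (Q z) ^+ 3)
    (fun z => (3 * f2 (Q z) ^+ 2 - f3 (Q z) * f1 (Q z)) / f1 (Q z) ^+ 5).
Proof.
move=> Do Eo QE FK QK FJ f10 z Dz.
have cF x : E x -> {for x, continuous F}.
  move=> /FJ[d _ _]; apply: differentiable_continuous.
  by apply/derivable1_diffP.
have [d1 d2 d3] := FJ _ (QE _ Dz).
have n0 := f10 _ (QE _ Dz).
have q1 := is_derive_inverse_on Do Eo Dz QE FK QK cF d1 n0.
have c1 := is_derive1_comp d2 q1.
have c2 := is_derive1_comp d3 q1.
split => //.
- apply: is_derive_eq (is_deriveV _ c1) _ => //=.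
  by rewrite /GRing.scale /=; field.
- have := is_deriveM (is_deriveN c2)
    (is_deriveV (f := fun z => f1 (Q z) ^+ 3) _ (is_deriveX 3 c1)).
  move=> /(_ (expf_neq0 _ n0)) H; apply: is_derive_eq H _ => /=.
  by rewrite /GRing.scale /= ?exprfctE opprfctE /=; field.
Qed.

(** Relates curvature to potential: the left-hand side is the
    projective curvature when [f1] is the density of [F]. *)
Lemma schwarzian_inverse (R : realType) (D E : set R) (F Q f1 f2 f3 : R -> R)
    (z : R) :
  open D -> open E -> (forall z, D z -> E (Q z)) ->
  (forall z, D z -> F (Q z) = z) -> (forall x, E x -> Q (F x) = x) ->
  jet3 E F f1 f2 f3 -> (forall x, E x -> f1 x != 0) -> D z ->
  schwarzian F (Q z) / f1 (Q z) ^+ 2 = - schwarzian Q z.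
Proof.
move=> Do Eo QE FK QK FJ f10 Dz.
have n0 := f10 _ (QE _ Dz).
rewrite (schwarzian_jet3 Do (jet3_inverse Do Eo QE FK QK FJ f10))//.
rewrite (schwarzian_jet3 Eo FJ); last exact: QE.
by field.
Qed.

(** * The Cauchy law and the rank dilations *)

Lemma cos_rank (R : realType) (u : R) : cos (pi * (u - 2^-1)) = sin (pi * u).
Proof. by rewrite mulrBr cosBpihalf. Qed.

Lemma sin_rank (R : realType) (u : R) :
  sin (pi * (u - 2^-1)) = - cos (pi * u).
Proof. by rewrite mulrBr sinBpihalf. Qed.

Lemma sin_rank_gt0 (R : realType) (u : R) : u \in `]0, 1[ -> 0 < sin (pi * u).
Proof.
rewrite in_itv/= => /andP[u0 u1]; apply: sin_gt0_pi.
by rewrite mulr_gt0 ?pi_gt0//= gtr_pMr ?pi_gt0.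
Qed.

Lemma rank_angle (R : realType) (u : R) : u \in `]0, 1[ ->
  pi * (u - 2^-1) \in `](- (pi / 2)), (pi / 2)[.
Proof.
rewrite !in_itv/= => /andP[u0 u1]; have p0 := pi_gt0 R.
by rewrite -mulrN !ltr_pM2l//; apply/andP; split; lra.
Qed.

Definition cauchy_cdf (R : realType) (y : R) : R := 2^-1 + atan y / pi.

Lemma cauchy_cdf_itv (R : realType) (y : R) : cauchy_cdf y \in `]0, 1[.
Proof.
have p0 := pi_gt0 R; have a1 := atan_gtNpi2 y; have a2 := atan_ltpi2 y.
rewrite in_itv/= /cauchy_cdf.
have : - 2^-1 < atan y / pi < 2^-1.
  by rewrite ltr_pdivlMr// ltr_pdivrMr//; apply/andP; split; lra.
by move=> /andP[b1 b2]; apply/andP; split; lra.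
Qed.

Lemma cauchy_cdfK (R : realType) : cancel (@cauchy_cdf R) (@cauchy_quantile R).
Proof.
move=> y; rewrite /cauchy_quantile /cauchy_cdf addrAC subrr add0r.
by rewrite mulrC divfK ?gt_eqF ?pi_gt0// atanK.
Qed.

Lemma cauchy_quantileK (R : realType) :
  {in `]0, 1[, cancel (@cauchy_quantile R) (@cauchy_cdf R)}.
Proof.
move=> u u01; rewrite /cauchy_quantile /cauchy_cdf tanK; last exact: rank_angle.
by rewrite mulrC mulKf ?gt_eqF ?pi_gt0// addrC subrK.
Qed.

Lemma sin_cauchy_cdf_sqr (R : realType) (y : R) :
  sin (pi * cauchy_cdf y) ^+ 2 = (1 + y ^+ 2)^-1.
Proof.
rewrite -cos_rank /cauchy_cdf addrAC subrr add0r mulrC.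
rewrite divfK ?gt_eqF ?pi_gt0// cos_atan exprVn sqr_sqrtr//.
by rewrite addr_ge0 ?sqr_ge0.
Qed.

Lemma cauchy_quantileE (R : realType) (u : R) :
  cauchy_quantile u = - cos (pi * u) / sin (pi * u).
Proof. by rewrite /cauchy_quantile /tan cos_rank sin_rank. Qed.

Lemma jet3_cauchy_cdf (R : realType) :
  jet3 setT (@cauchy_cdf R) (fun y => (pi * (1 + y ^+ 2))^-1)
    (fun y => - (2 * y) / (pi * (1 + y ^+ 2) ^+ 2))
    (fun y => (6 * y ^+ 2 - 2) / (pi * (1 + y ^+ 2) ^+ 3)).
Proof.
have p0 : pi != 0 :> R by rewrite gt_eqF ?pi_gt0.
rewrite /cauchy_cdf; move: (pi : R) p0 => p p0 y _.
have n0 : 1 + y ^+ 2 != 0 by rewrite gt_eqF// ltr_pwDl ?sqr_ge0.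
split.
- by apply: is_derive_eq; rewrite /GRing.scale /=; field; rewrite p0 n0.
- have dd : is_derive y 1 (fun y : R => p * (1 + y ^+ 2)) (p * (2 * y)).
    by apply: is_derive_eq; rewrite /GRing.scale /=; ring.
  apply: is_derive_eq (is_derive1V _ dd) _; first by rewrite mulf_neq0.
  by field; rewrite p0 n0.
- have dd : is_derive y 1 (fun y : R => p * (1 + y ^+ 2) ^+ 2)
      (p * (2 * (1 + y ^+ 2) * (2 * y))).
    by apply: is_derive_eq; rewrite /GRing.scale /=; ring.
  have dV := is_derive1V (f := fun y => p * (1 + y ^+ 2) ^+ 2)
    (mulf_neq0 p0 (expf_neq0 2 n0)) dd.
  by apply: is_derive_eq; rewrite /GRing.scale /=; field; rewrite p0 n0.
Qed.

Lemma jet3_cauchy_quantile (R : realType) :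
  jet3 `]0, 1[%classic (@cauchy_quantile R)
    (fun u => pi * (1 + cauchy_quantile u ^+ 2))
    (fun u => 2 * pi ^+ 2 *
       (cauchy_quantile u * (1 + cauchy_quantile u ^+ 2)))
    (fun u => 2 * pi ^+ 3 *
       ((1 + cauchy_quantile u ^+ 2) * (1 + 3 * cauchy_quantile u ^+ 2))).
Proof.
move=> u u01.
have c0 : cos (pi * (u - 2^-1)) != 0.
  by rewrite cos_rank gt_eqF// sin_rank_gt0.
have dl : is_derive u 1 (fun u : R => pi * (u - 2^-1)) pi.
  by apply: is_derive_eq; rewrite /GRing.scale /=; ring.
have dV : is_derive u 1 (@cauchy_quantile R)
    (pi * (1 + cauchy_quantile u ^+ 2)).
  apply: is_derive_eq (is_derive1_comp (f := tan)
    (g := fun u => pi * (u - 2^-1)) (is_derive_tan c0) dl) _.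
  by rewrite cos2_tan2// mulrC.
by split=> //; apply: is_derive_eq; rewrite /GRing.scale /=; ring.
Qed.

(** The Cauchy law has constant potential; this constant
    is the equilibrium of the flow. *)
Lemma schwarzian_cauchy_quantile (R : realType) (u : R) : u \in `]0, 1[ ->
  schwarzian (@cauchy_quantile R) u = 2 * pi ^+ 2.
Proof.
move=> u01.
rewrite (schwarzian_jet3 _ (@jet3_cauchy_quantile R))//.
have p0 : pi != 0 :> R by rewrite gt_eqF ?pi_gt0.
move: (cauchy_quantile u) (pi : R) p0 => v p p0.
by field; rewrite p0 gt_eqF// ltr_pwDl ?sqr_ge0.
Qed.

(** The flow on ranks: multiplication by e^s in the Cauchy coordinate. *)
Definition dilate (R : realType) (s u : R) : R :=
  cauchy_cdf (expR s * cauchy_quantile u).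

(** The derivative of [dilate s] at [u], written with sine and cosine
    so that it is positive and continuous on the whole line, whereas
    [cauchy_quantile] is discontinuous at ranks 0 and 1. The form in the Cauchy
    coordinate is [dilate_derivE]. *)
Definition dilate_deriv (R : realType) (s u : R) : R :=
  (expR (- s) * sin (pi * u) ^+ 2 + expR s * cos (pi * u) ^+ 2)^-1.

Lemma dilateNK (R : realType) (s : R) :
  {in `]0, 1[, cancel (@dilate R (- s)) (dilate s)}.
Proof.
move=> u u01; rewrite /dilate cauchy_cdfK mulrA expRN mulfV ?mul1r.
  exact: cauchy_quantileK.
by rewrite gt_eqF ?expR_gt0.
Qed.

Lemma dilateK (R : realType) (s : R) :
  {in `]0, 1[, cancel (@dilate R s) (dilate (- s))}.
Proof. by move=> u u01; have := dilateNK (- s) u01; rewrite opprK. Qed.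

Lemma dilate_deriv_den_gt0 (R : realType) (s u : R) :
  0 < expR (- s) * sin (pi * u) ^+ 2 + expR s * cos (pi * u) ^+ 2.
Proof.
have e1 := expR_gt0 s; have e2 := expR_gt0 (- s).
have := cos2Dsin2 (pi * u).
have := sqr_ge0 (cos (pi * u)); have := sqr_ge0 (sin (pi * u)).
move: (sin _ ^+ 2) (cos _ ^+ 2) => S C S0 C0 SC.
have [S1|S1] := ltP 0 S.
  by rewrite ltr_pwDl ?mulr_gt0// mulr_ge0// ltW.
apply: ltr_wpDl; first by rewrite mulr_ge0// ltW.
by rewrite mulr_gt0//; lra.
Qed.

Lemma dilate_deriv_gt0 (R : realType) (s u : R) : 0 < dilate_deriv s u.
Proof. by rewrite invr_gt0 dilate_deriv_den_gt0. Qed.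

Lemma dilate_deriv_le (R : realType) (s u : R) : 0 <= s ->
  dilate_deriv s u <= expR s.
Proof.
move=> s0; rewrite -[leRHS]invrK -expRN lef_pV2 ?posrE ?expR_gt0
  ?dilate_deriv_den_gt0//.
rewrite -[leLHS]mulr1 -(cos2Dsin2 (pi * u)) addrC mulrDr lerD2l.
by rewrite ler_wpM2r ?sqr_ge0// ler_expR; lra.
Qed.

Lemma dilate_deriv0 (R : realType) (u : R) : dilate_deriv 0 u = 1.
Proof.
by rewrite /dilate_deriv oppr0 expR0 !mul1r addrC cos2Dsin2 invr1.
Qed.

Lemma dilate_derivE (R : realType) (s u : R) : u \in `]0, 1[ ->
  dilate_deriv s u = expR s * (1 + cauchy_quantile u ^+ 2)
                     / (1 + (expR s * cauchy_quantile u) ^+ 2).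
Proof.
move=> /sin_rank_gt0 S0; rewrite /dilate_deriv cauchy_quantileE expRN.
have := dilate_deriv_den_gt0 s u; rewrite expRN.
have := cos2Dsin2 (pi * u); move: (expR_gt0 s) S0.
set S := sin _; set C := cos _; set e := expR s => e0 S0 SC D0.
have S2 : S ^+ 2 != 0 by rewrite expf_neq0 ?gt_eqF.
have D1 : S ^+ 2 + e ^+ 2 * C ^+ 2 != 0.
  rewrite gt_eqF// ltr_pwDl ?exprn_gt0//.
  by rewrite mulr_ge0 ?sqr_ge0.
have -> : 1 + (- C / S) ^+ 2 = (S ^+ 2)^-1.
  rewrite exprMn exprVn sqrrN -{1}(divff S2) -mulrDl addrC SC.
  by rewrite mul1r.
by field; rewrite exprMn sqrrN D1 !gt_eqF.
Qed.

Lemma cauchy_quantile_deriv_neq0 (R : realType) (u : R) :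
  pi * (1 + cauchy_quantile u ^+ 2) != 0.
Proof. by rewrite mulf_neq0// gt_eqF ?pi_gt0// ltr_pwDl ?sqr_ge0. Qed.

Lemma jet3_dilate (R : realType) (s : R) :
  exists k2 k3 : R -> R,
    jet3 `]0, 1[%classic (dilate s) (dilate_deriv s) k2 k3.
Proof.
have o01 : open (`]0, 1[%classic : set R) by [].
have H := jet3_comp (fun _ _ => I) (jet3Z (expR s) (@jet3_cauchy_quantile R))
  (@jet3_cauchy_cdf R).
do 2 eexists; apply: (jet3_eq_on o01 _ _ H) => // u u01.
rewrite dilate_derivE//=.
have p0 : pi != 0 :> R by rewrite gt_eqF ?pi_gt0.
move: (cauchy_quantile u) (pi : R) p0 (expR s) => v p p0 e.
by field; rewrite p0 gt_eqF// ltr_pwDl ?sqr_ge0.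
Qed.

(** Apply the chain rule to V o phi_s = e^s V: both V and e^s V have
    Schwarzian 2 pi^2. *)
Lemma schwarzian_dilate (R : realType) (s u : R) : u \in `]0, 1[ ->
  schwarzian (dilate s) u = 2 * pi ^+ 2 - 2 * pi ^+ 2 * dilate_deriv s u ^+ 2.
Proof.
move=> u01; have [k2 [k3 kJ]] := jet3_dilate s.
have o01 : open (`]0, 1[%classic : set R) by [].
have k01 v : `]0, 1[%classic v -> `]0, 1[%classic (dilate s v).
  by move=> _; exact: cauchy_cdf_itv.
have := schwarzian_comp o01 o01 k01 kJ (@jet3_cauchy_quantile R) u01
  (lt0r_neq0 (dilate_deriv_gt0 s u)) (cauchy_quantile_deriv_neq0 _).
rewrite schwarzian_cauchy_quantile; last exact: cauchy_cdf_itv.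
have -> : @cauchy_quantile R \o dilate s = fun v => expR s * cauchy_quantile v.
  by apply/funext => v /=; rewrite cauchy_cdfK.
rewrite (schwarzianZ o01 (@jet3_cauchy_quantile R) u01
  (lt0r_neq0 (expR_gt0 s)) (cauchy_quantile_deriv_neq0 u)).
rewrite schwarzian_cauchy_quantile// => H.
by apply/esym/eqP; rewrite subr_eq addrC; apply/eqP.
Qed.

(** The explicit solution satisfies the flow equation, in
    logarithmic form: this is the coefficient of the canonical flow at rank
    [dilate t u]. *)
Lemma is_derive_ln_dilate_deriv (R : realType) (u t : R) : u \in `]0, 1[ ->
  is_derive t 1 (fun s => ln (dilate_deriv s u))
    (2 * sin (pi * dilate t u) ^+ 2 - 1).
Proof.
move=> u01; rewrite sin_cauchy_cdf_sqr cauchy_quantileE.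
have := sin_rank_gt0 u01; have := dilate_deriv_den_gt0 t u.
rewrite (_ : (fun s => _) = fun s => - ln (expR (- s) * sin (pi * u) ^+ 2 +
    expR s * cos (pi * u) ^+ 2)); last first.
  by apply/funext => s; rewrite /dilate_deriv lnV// posrE dilate_deriv_den_gt0.
move: (sin _) (cos _) => S C D0 S0.
set D := fun s => expR (- s) * S ^+ 2 + expR s * C ^+ 2.
have dD : is_derive t 1 D (- expR (- t) * S ^+ 2 + expR t * C ^+ 2).
  by rewrite /D; apply: is_derive_eq; rewrite /GRing.scale /=; ring.
have dl := is_derive1_comp (g := D) (is_derive1_ln D0) dD.
have dN := is_deriveN dl.
apply: is_derive_eq dN _.
rewrite expRN; have := expR_gt0 t; move: (expR t) => e e0.
have D1 : S ^+ 2 + e ^+ 2 * C ^+ 2 != 0.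
  by rewrite gt_eqF// ltr_pwDl ?exprn_gt0// mulr_ge0 ?sqr_ge0.
by field; rewrite exprMn sqrrN D1 !gt_eqF.
Qed.

Lemma dilate_le (R : realType) (s : R) :
  {in `]0, 1[ &, {homo dilate s : u v / u <= v}}.
Proof.
move=> u v u01 v01; rewrite le_eqVlt => /predU1P[->//|uv].
rewrite lerD2l ler_pM2r ?invr_gt0 ?pi_gt0//; apply: le_atan.
rewrite ler_pM2l ?expR_gt0// ltW// /cauchy_quantile ltr_tan ?rank_angle//.
by rewrite ltr_pM2l ?pi_gt0// ltrD2r.
Qed.

Lemma dilate_derivN_le (R : realType) (t z : R) : z \in `]0, 1[ ->
  dilate_deriv (- t) z ^+ 2 <=
  expR (- (2 * t)) * (1 + cauchy_quantile z ^+ 2) ^+ 2.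
Proof.
move=> z01; rewrite dilate_derivE//.
have -> : expR (- (2 * t)) = expR (- t) ^+ 2.
  by rewrite -expRM_natl mulrN.
rewrite -exprMn ler_sqr ?nnegrE.
- rewrite ler_pdivrMr ?ltr_pwDl ?sqr_ge0//.
  rewrite ler_peMr ?lerDl ?sqr_ge0//.
  by rewrite mulr_ge0 ?expR_ge0// addr_ge0 ?sqr_ge0.
- by rewrite divr_ge0 ?mulr_ge0 ?expR_ge0// addr_ge0 ?sqr_ge0.
- by rewrite mulr_ge0 ?expR_ge0// addr_ge0 ?sqr_ge0.
Qed.

Lemma expR_dilate_derivN (R : realType) (t z : R) : z \in `]0, 1[ ->
  expR (2 * t) * dilate_deriv (- t) z ^+ 2 =
  (1 + cauchy_quantile z ^+ 2) ^+ 2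
    / (1 + expR (- (2 * t)) * cauchy_quantile z ^+ 2) ^+ 2.
Proof.
move=> z01; rewrite dilate_derivE// -mulrN !expRM_natl expRN.
have := expR_gt0 t; move: (expR t) (cauchy_quantile z) => e v e0.
have d0 : e ^+ 2 + v ^+ 2 != 0 by rewrite gt_eqF// ltr_pwDl ?exprn_gt0 ?sqr_ge0.
by field; rewrite d0 gt_eqF.
Qed.

(** * Distribution functions of probability densities *)

Section distribution_function.
Variables (R : realType) (f : R -> R).
Hypothesis fD : probability_density f.

Lemma density_integrable (A : set R) : measurable A ->
  (@mu R).-integrable A (EFin \o f).
Proof.
move=> mA; have [mf f0 f1] := fD.
apply: (@integrableS _ _ _ _ setT) => //.
apply/integrableP; split; first exact/measurable_EFinP.
under eq_integral => x _ do rewrite gee0_abs ?lee_fin//.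
by rewrite f1 ltry.
Qed.

Lemma distrB (a b : R) : a <= b ->
  distr f b - distr f a = \int[mu]_(x in `]a, b]) f x.
Proof.
move=> ab; rewrite /distr Rintegral_itvB ?bnd_simp//.
exact: density_integrable.
Qed.

Lemma distr_le (a b : R) : a <= b -> distr f a <= distr f b.
Proof.
have [_ f0 _] := fD.
by move=> ab; rewrite -subr_ge0 distrB// Rintegral_ge0.
Qed.

Lemma distr_ge0 (a : R) : 0 <= distr f a.
Proof. by have [_ f0 _] := fD; rewrite Rintegral_ge0. Qed.

Lemma Rintegral_density (A : set R) : measurable A ->
  0 <= \int[mu]_(x in A) f x <= 1.
Proof.
move=> mA; have [mf f0 f1] := fD; apply/andP; split; first exact: Rintegral_ge0.
rewrite -lee_fin /Rintegral fineK; last first.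
  by apply: integrable_fin_num => //; exact: density_integrable.
rewrite -f1; apply: ge0_subset_integral => //.
  exact/measurable_EFinP.
by move=> x _; rewrite lee_fin.
Qed.

Lemma distr_le1 (a : R) : distr f a <= 1.
Proof. by have /andP[] := Rintegral_density (measurable_itv `]-oo, a]). Qed.

(** On an interval to the right of a base point, the distribution
    function is a constant plus an integral with a finite lower bound. *)
Lemma distr_continuous : continuous (distr f).
Proof.
move=> x; pose a := x - 1; pose b := x + 1.
have ab : a < b by rewrite /a /b; lra.
have xab : x \in `]a, b[ by rewrite in_itv/= /a /b; apply/andP; split; lra.
have H := parameterized_integral_continuous (ltW ab)
  (density_integrable (measurable_itv `[a, b])).
have {}H := within_continuous_continuous ab H xab.
have HE y : a <= y -> distr f a + parameterized_integral mu a y f = distr f y.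
  move=> ay; rewrite /parameterized_integral -Rintegral_itv_obnd_cbnd.
    by rewrite -distrB// addrC subrK.
  exact: density_integrable.
rewrite /continuous_at -HE; last by rewrite /a; lra.
have HD : {for x, continuous (fun y =>
    distr f a + parameterized_integral mu a y f)}.
  by apply: continuousD => //; exact: cst_continuous.
apply: cvg_trans HD; apply: near_eq_cvg.
by apply: filterS (near_in_itvoo xab) => y yab; rewrite HE// (itvP yab).
Qed.

(** The masses of [-n, n] increase to 1, which controls both tails. *)
Lemma distr_exhaust (e : R) : 0 < e ->
  exists n : R, distr f (- n) < e /\ 1 - e < distr f n.
Proof.
move=> e0; have [mf f0 f1] := fD.
pose F (n : nat) := `[- n%:R, n%:R]%classic : set R.
have UF : \bigcup_i F i = setT.
  apply/seteqP; split=> // x _; exists (Num.bound `|x|) => //=.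
  have := archi_boundP (normr_ge0 x); rewrite /F/= in_itv/= => xb.
  by rewrite -ler_norml ltW.
have H : \int[mu]_(x in F n) f x @[n --> \oo] --> (1 : R).
  apply: fine_cvg; rewrite -f1 -UF.
  apply: (@ge0_nondecreasing_set_cvg_integral _ (measurableTypeR R) R F
    (EFin \o f) (@lebesgue_measure R)).
  - apply/nondecreasing_seqP => n; rewrite subsetEset => x.
    rewrite /F/= !in_itv/= -!ler_norml => /le_trans; apply.
    by rewrite ler_nat.
  - by move=> n; exact: measurable_itv.
  - by move=> n; apply/measurable_EFinP; exact: measurable_funTS.
  - by move=> n x _; rewrite lee_fin.
have [n _ /(_ n (leqnn n)) Hn] := cvgr_gt 1 H (1 - e) ltac:(lra).
exists n%:R.
have n0 : - n%:R <= n%:R :> R by rewrite -subr_ge0 opprK.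
have := distrB n0.
rewrite Rintegral_itv_obnd_cbnd; last exact: density_integrable.
rewrite -/(F n) => E.
have := distr_ge0 (- n%:R); have := distr_le1 n%:R => A1 A2.
move: (distr f n%:R) (distr f _) (\int[mu]_(x in F n) f x) E A1 A2 Hn.
clear => p q r E A1 A2 Hn; split; lra.
Qed.

Lemma distr_surj (z : R) : z \in `]0, 1[ -> exists x, distr f x = z.
Proof.
rewrite in_itv/= => /andP[z0 z1].
have [n [n0 _]] := distr_exhaust z0.
have z1' : 0 < 1 - z by rewrite subr_gt0.
have [m [_ m1]] := distr_exhaust z1'.
rewrite subKr in m1.
have nm : - n <= m.
  by rewrite leNgt; apply/negP => /ltW/distr_le; rewrite leNgt (lt_trans n0).
have [||x _ xz] := @IVT _ (distr f) (- n) m z nm.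
- exact/continuous_subspaceT/distr_continuous.
- by rewrite min_l ?max_r ?(ltW n0) ?(ltW m1)//; exact: distr_le.
- by exists x.
Qed.

(** A point outside the interval that carries the density has all the mass on
    one side. *)
Lemma distr_off (I : set R) (x : R) : is_interval I ->
  (forall y, ~ I y -> f y = 0) -> ~ I x -> distr f x = 0 \/ distr f x = 1.
Proof.
move=> iI fI nIx; have [mf f0 f1] := fD.
have [[y [Iy yx]]|H] := pselect (exists y, I y /\ y < x).
  right; rewrite /distr /Rintegral.
  rewrite (_ : (\int[mu]_(y in `]-oo, x]) (f y)%:E = 1)%E)// -f1.
  rewrite integral_mkcond; apply: eq_integral => w _.
  rewrite patchE; case: ifPn => // /negP wx.
  rewrite fI// => Iw; apply: nIx; apply: (iI y w) => //.
  rewrite (ltW yx)/=; apply: ltW; rewrite ltNge; apply/negP => wx'.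
  by apply: wx; rewrite inE/= in_itv.
left; rewrite /distr (@eq_Rintegral _ _ _ _ _ (cst 0)) ?Rintegral_cst ?mul0r//.
move=> w; rewrite inE/= in_itv/= le_eqVlt => /predU1P[->|wx]; rewrite fI//.
by move=> Iw; apply: H; exists w.
Qed.

End distribution_function.

Lemma is_derive_distr (R : realType) (g : R -> R) (x : R) :
  (@lebesgue_measure R).-integrable setT (EFin \o g) ->
  {for x, continuous g} -> is_derive x 1 (distr g) (g x).
Proof.
move=> ig cg; have xu : x < x + 1 by rewrite ltrDl.
have igu : (@lebesgue_measure R).-integrable `]-oo, x + 1] (EFin \o g).
  by apply: integrableS ig.
have [d1 d2] := continuous_FTC1 xu igu (ltNyr _) cg.
by apply: DeriveDef => //; rewrite -derive1E.
Qed.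

(** * Calculus estimates *)

Lemma MVT_is_derive (R : realType) (h dh : R -> R) (a b : R) : a < b ->
  (forall x, x \in `[a, b] -> is_derive x 1 h (dh x)) ->
  exists2 c, c \in `]a, b[ & h b - h a = dh c * (b - a).
Proof.
move=> ab dhP.
have dho x : x \in `]a, b[ -> is_derive x 1 h (dh x).
  by move=> xab; apply: dhP; exact: subset_itv_oo_cc xab.
have ch : {within `[a, b], continuous h}.
  by apply: derivable_within_continuous => x /dhP[].
exact: MVT ab dho ch.
Qed.

(** The flow is differentiable only at positive times and merely
    continuous at 0, hence the one-sided condition. *)
Lemma nondecreasing_from0 (R : realType) (h dh : R -> R) :
  (forall t : R, 0 < t -> is_derive t 1 h (dh t)) ->
  (forall t, 0 < t -> 0 <= dh t) -> h t @[t --> 0^'+] --> h 0 ->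
  forall t, 0 <= t -> h 0 <= h t.
Proof.
move=> dhP dh0 h0 t t0; apply: (@ger0_derive1_ndecry R h 0) => //.
- by move=> x; rewrite in_itv/= andbT => /dhP[].
- move=> x; rewrite in_itv/= andbT => x0; have dx := dhP x x0.
  by rewrite derive1E derive_val dh0.
- apply/continuous_within_itvcyP; split => // x; rewrite in_itv/= andbT => x0.
  have [d _] := dhP x x0.
  by apply: differentiable_continuous; exact/derivable1_diffP.
Qed.

Lemma is_derive_at_right (R : realType) (h : R -> R) (x l : R) :
  is_derive x 1 h l -> h t @[t --> x^'+] --> h x.
Proof.
move=> [d _]; apply: cvg_at_right_filter.
by apply: differentiable_continuous; exact/derivable1_diffP.
Qed.

Lemma sin_sqr_lipschitz (R : realType) (a b : R) :
  `|2 * sin (pi * a) ^+ 2 - 2 * sin (pi * b) ^+ 2| <= 4 * pi * `|a - b|.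
Proof.
wlog ab : a b / b <= a.
  move=> H; have [|ba] := leP b a; first exact: H.
  by rewrite distrC (distrC a); apply: H; exact: ltW.
move: ab; rewrite le_eqVlt => /predU1P[->|ab].
  by rewrite !subrr !normr0 mulr0.
have dh (x : R) : x \in `[b, a] ->
    is_derive x 1 (fun x => 2 * sin (pi * x) ^+ 2)
    (4 * pi * (sin (pi * x) * cos (pi * x))).
  move=> _; have dl : is_derive x 1 (fun x : R => pi * x) pi.
    by apply: is_derive_eq; rewrite /GRing.scale /=; ring.
  have dS := is_derive1_comp (f := sin) (g := fun x : R => pi * x)
    (is_derive_sin (pi * x)) dl.
  have {}dS : is_derive x 1 (fun x : R => sin (pi * x)) (cos (pi * x) * pi).
    by [].
  by apply: is_derive_eq; rewrite /GRing.scale /=; move: (pi : R) => p; ring.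
have [c _ ->] := MVT_is_derive ab dh.
rewrite normrM ler_wpM2r// normrM ger0_norm ?mulr_ge0 ?pi_ge0//.
rewrite -[leRHS]mulr1 ler_wpM2l ?mulr_ge0 ?pi_ge0//.
rewrite normrM mulr_ile1// ler_norml ?sin_geN1 ?sin_le1 ?cos_geN1 ?cos_le1//.
Qed.

(** A weak form of the logarithmic mean inequality. Its point is that the
    right-hand side integrates to the total mass, without any smallness
    assumption on the logarithms. *)
Lemma normB_le_ln (R : realType) (a b : R) : 0 < a -> 0 < b ->
  `|a - b| <= `|ln a - ln b| * (a + b).
Proof.
wlog ab : a b / b <= a.
  move=> H a0 b0; have [ba|ba] := leP b a; first exact: H.
  by rewrite distrC (distrC (ln a)) (addrC a); apply: H => //; exact: ltW.
move=> a0 b0; have lba : ln b <= ln a by rewrite ler_ln.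
rewrite !ger0_norm ?subr_ge0//.
have : ln (b / a) <= b / a - 1.
  have := @le_ln1Dx R (b / a - 1); rewrite (addrC 1) subrK; apply.
  by rewrite ltrBDl subrr divr_gt0.
rewrite ln_div// => H.
have : (a - b) / a <= ln a - ln b.
  by rewrite mulrBl divff ?gt_eqF//; lra.
rewrite ler_pdivrMr// => /le_trans; apply.
by rewrite ler_wpM2l ?subr_ge0// lerDl ltW.
Qed.

(** * The dilated density *)

(** What the flow argument uses of the initial density; two derivatives
    are only needed for the potential. *)
Definition density_on (R : realType) (I : set R) (f : R -> R) : Prop :=
  [/\ probability_density f, open I /\ is_interval I,
      forall x, I x -> 0 < f x, forall x, ~ I x -> f x = 0
    & forall x, I x -> {for x, continuous f}].

Section explicit_flow.
Variables (R : realType) (f0 : R -> R) (I : set R).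
Hypothesis f0I : density_on I f0.

Let f0D : probability_density f0. Proof. by case: f0I. Qed.
Let Io : open I. Proof. by case: f0I => _ []. Qed.
Let iI : is_interval I. Proof. by case: f0I => _ []. Qed.
Let f0_gt0 x : I x -> 0 < f0 x. Proof. by case: f0I => _ _ + _ _; exact. Qed.
Let f0_off x : ~ I x -> f0 x = 0.
Proof. by case: f0I => _ _ _ + _; exact. Qed.
Let f0_cont x : I x -> {for x, continuous f0}.
Proof. by case: f0I => _ _ _ _; exact. Qed.

Lemma distr_lt (x y : R) : I x -> I y -> x < y -> distr f0 x < distr f0 y.
Proof.
move=> Ix Iy xy.
have Izz z : z \in `[x, y] -> I z by rewrite in_itv/=; exact: iI.
have [|c cxy E] := @MVT_is_derive _ (distr f0) f0 x y xy.
  move=> z /Izz Iz; apply: is_derive_distr; last exact: f0_cont.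
  exact: (density_integrable f0D).
rewrite -subr_gt0 E mulr_gt0 ?subr_gt0// f0_gt0//.
by apply: Izz; exact: subset_itv_oo_cc cxy.
Qed.

(** Outside [I] the distribution function only takes the values 0 and 1. *)
Lemma distr_mem (x : R) : distr f0 x \in `]0, 1[ -> I x.
Proof.
move=> H; apply: contrapT => nI.
by move: H; have [->|->] := distr_off f0D iI f0_off nI;
  rewrite in_itv/= ltxx ?andbF.
Qed.

Lemma distr_itv (x : R) : I x -> distr f0 x \in `]0, 1[.
Proof.
move=> Ix; near (0 : R)^'+ => e.
have e0 : 0 < e by [].
have H : `[x - e, x + e]%classic `<=` I by near: e; exact: open_itvcc_subset.
have Il : I (x - e) by apply: H; rewrite /= in_itv/=; apply/andP; split; lra.
have Ir : I (x + e) by apply: H; rewrite /= in_itv/=; apply/andP; split; lra.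
rewrite in_itv/=; apply/andP; split.
  by apply: le_lt_trans (distr_ge0 f0D (x - e)) _; apply: distr_lt => //; lra.
by apply: lt_le_trans (distr_le1 f0D (x + e)); apply: distr_lt => //; lra.
Unshelve. all: by end_near. Qed.

Lemma distr_inj (x y : R) : I x -> I y -> distr f0 x = distr f0 y -> x = y.
Proof.
move=> Ix Iy E; apply/eqP; rewrite eq_le !leNgt; apply/andP; split; apply/negP.
  by move=> /(distr_lt Iy Ix); rewrite E ltxx.
by move=> /(distr_lt Ix Iy); rewrite E ltxx.
Qed.

Lemma distr_quantile (z : R) : z \in `]0, 1[ ->
  distr f0 (quantile f0 z) = z /\ I (quantile f0 z).
Proof.
move=> z01; have [x Ex] := distr_surj f0D z01.
have Q : distr f0 (quantile f0 z) = z.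
  by apply: (@xgetPex _ 0 [set x | distr f0 x = z]); exists x.
by split=> //; apply: distr_mem; rewrite Q.
Qed.

(** The explicit solution of the flow, the density of
    [dilate t] composed with the initial distribution function. *)
Definition dilated_density (t x : R) : R := f0 x * dilate_deriv t (distr f0 x).

Lemma dilated_density_ge0 (t x : R) : 0 <= dilated_density t x.
Proof.
by have [_ p0 _] := f0D; rewrite mulr_ge0// ltW// dilate_deriv_gt0.
Qed.

Lemma dilated_density_le (t x : R) : 0 <= t ->
  dilated_density t x <= expR t * f0 x.
Proof.
have [_ p0 _] := f0D => t0.
by rewrite /dilated_density mulrC ler_wpM2r// dilate_deriv_le.
Qed.

Lemma continuous_dilate_deriv (t : R) : continuous (dilate_deriv t).
Proof.
move=> u.
have cp : {for u, continuous (fun u : R => pi * u)} by exact: mulrl_continuous.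
have cs : {for u, continuous (fun u : R => sin (pi * u))}.
  by apply: (continuous_comp cp); exact: continuous_sin.
have cc : {for u, continuous (fun u : R => cos (pi * u))}.
  by apply: (continuous_comp cp); exact: continuous_cos.
rewrite /continuous_at /dilate_deriv.
apply: cvgV; first by rewrite gt_eqF// dilate_deriv_den_gt0.
by apply: cvgD; apply: cvgMr; exact: cvgM.
Qed.

Lemma dilated_density_cont (t x : R) : I x ->
  {for x, continuous (dilated_density t)}.
Proof.
move=> Ix; apply: continuousM; first exact: f0_cont.
apply: continuous_comp; first exact: distr_continuous.
exact: continuous_dilate_deriv.
Qed.

Lemma dilated_density_measurable (t : R) :
  measurable_fun setT (dilated_density t).
Proof.
have [mf _ _] := f0D; apply: measurable_funM => //.
apply: continuous_measurable_fun => x; apply: continuous_comp.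
  exact: distr_continuous.
exact: continuous_dilate_deriv.
Qed.

Lemma dilated_density_integrable (t : R) (A : set R) : 0 <= t -> measurable A ->
  (@mu R).-integrable A (EFin \o dilated_density t).
Proof.
move=> t0 mA.
have H : (@mu R).-integrable A (fun x => (expR t)%:E * (f0 x)%:E)%E.
  by apply: integrableZl => //; exact: (density_integrable f0D mA).
apply: le_integrable H => //.
  apply/measurable_EFinP; apply: measurable_funTS.
  exact: dilated_density_measurable.
move=> x _; rewrite -EFinM/= lee_fin !ger0_norm ?dilated_density_ge0//.
  exact: dilated_density_le.
by have [_ p0 _] := f0D; rewrite mulr_ge0// expR_ge0.
Qed.

Lemma distr_dilated_le (t x : R) : 0 <= t ->
  distr (dilated_density t) x <= expR t * distr f0 x.
Proof.
move=> t0; rewrite /distr -RintegralZl//; last exact: density_integrable.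
apply: le_Rintegral => //.
- exact: dilated_density_integrable.
- exact: (integrableZl _ _ (density_integrable f0D _)).
- by move=> y _; exact: dilated_density_le.
Qed.

(** Both sides have the same derivative on [I], so their difference [H] is
    constant there. Moving to the left end of [I], where the initial
    distribution function is small, both sides become small; hence [H] is 0. *)
Lemma distr_dilated (t x : R) : 0 <= t -> I x ->
  distr (dilated_density t) x = dilate t (distr f0 x).
Proof.
have [mf p0 _] := f0D; move=> t0 Ix.
pose H y := distr (dilated_density t) y - dilate t (distr f0 y).
have dH y : I y -> is_derive y 1 H 0.
  move=> Iy.
  have d1 : is_derive y 1 (distr (dilated_density t)) (dilated_density t y).
    apply: is_derive_distr; last exact: dilated_density_cont.
    exact: dilated_density_integrable.
  have [k2 [k3 /(_ _ (distr_itv Iy))[dk _ _]]] := jet3_dilate t.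
  have dF : is_derive y 1 (distr f0) (f0 y).
    apply: is_derive_distr; last exact: f0_cont.
    exact: (density_integrable f0D).
  have := is_deriveB d1 (is_derive1_comp dk dF).
  by rewrite /dilated_density mulrC subrr.
have H0 y : I y -> y < x -> H x = H y.
  move=> Iy yx; have [|c _] := @MVT_is_derive _ H (cst 0) y x yx.
    move=> z zyx; apply: dH; apply: iI zyx => //.
  by rewrite mul0r => /eqP; rewrite subr_eq0 => /eqP.
have Hsmall (e : R) : e \in `]0, 1[ -> `|H x| <= e.
  move=> e01; have e0 : 0 < e by rewrite (itvP e01).
  have Fx := distr_itv Ix.
  have De := cauchy_cdf_itv (expR (- t) * cauchy_quantile e).
  (* the first term makes [dilate t u] at most e, the second bounds the
     distribution function of the dilated density, the third puts y < x *)
  pose u := Num.min (dilate (- t) e)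
    (Num.min (expR (- t) * e) (distr f0 x / 2)).
  have u0 : 0 < u.
    rewrite !lt_min (itvP De) mulr_gt0 ?expR_gt0// divr_gt0//.
    by rewrite (itvP Fx).
  have u1 : u < distr f0 x.
    rewrite /u !gt_min; apply/orP; right; apply/orP; right.
    by rewrite ltr_pdivrMr// ltr_pMr ?(itvP Fx)//; lra.
  have u01 : u \in `]0, 1[ by rewrite in_itv/= u0 (lt_trans u1)// (itvP Fx).
  have [Qu Iu] := distr_quantile u01.
  set y := quantile f0 u in Qu Iu.
  have yx : y < x.
    rewrite ltNge; apply/negP => /(distr_le f0D).
    by rewrite Qu leNgt u1.
  rewrite (H0 y)// /H Qu ler_norml; apply/andP; split.
    have : dilate t u <= e.
      rewrite -[leRHS](dilateNK t e01); apply: dilate_le => //.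
      by rewrite /u ge_min lexx.
    have : 0 <= distr (dilated_density t) y.
      by rewrite /distr Rintegral_ge0// => z _; exact: dilated_density_ge0.
    by move: (distr _ y) (dilate t u) => p q A B; lra.
  have : distr (dilated_density t) y <= e.
    apply: le_trans (distr_dilated_le y t0) _.
    rewrite Qu mulrC -ler_pdivlMr ?expR_gt0// -expRN mulrC.
    by rewrite /u !ge_min lexx orbT.
  have := cauchy_cdf_itv (expR t * cauchy_quantile u).
  rewrite -/(dilate t u) in_itv/= => /andP[+ _].
  by move: (distr _ y) (dilate t u) => p q A B; lra.
apply/eqP; rewrite -subr_eq0 -/(H x) -normr_le0 leNgt; apply/negP => Hx.
have e01 : Num.min (`|H x| / 2) 2^-1 \in `]0, 1[.
  rewrite in_itv/= lt_min gt_min divr_gt0//= invr_gt0 ltr0n/=.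
  by rewrite invf_lt1// ltr1n orbT.
have := Hsmall _ e01; rewrite le_min => /andP[+ _].
by move: Hx; lra.
Qed.
End explicit_flow.

(** * Uniqueness of the canonical flow *)

Section flow_solution.
Variables (R : realType) (f0 : R -> R) (I : set R) (f : R -> R -> R).
Hypothesis f0I : density_on I f0.
Hypothesis fl : canonical_flow f0 f.

Let f0D : probability_density f0. Proof. by case: f0I. Qed.
Let f0_gt0 x : I x -> 0 < f0 x. Proof. by case: f0I => _ _ + _ _; exact. Qed.
Let f0_off x : ~ I x -> f0 x = 0.
Proof. by case: f0I => _ _ _ + _; exact. Qed.

Lemma flow_right0 (x : R) : f s x @[s --> 0^'+] --> f0 x.
Proof.
by have [<- _ /(_ x) /continuous_within_itvcyP[]] := fl.
Qed.

(** The coefficient 2 sin^2 - 1 of the flow lies between -1 and 1, so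
    e^t f_t is nondecreasing and e^{-t} f_t nonincreasing in t. *)
Lemma flow_lower (t x : R) : 0 <= t -> expR (- t) * f0 x <= f t x.
Proof.
have [f00 fD _ df] := fl.
move=> t0; rewrite expRN mulrC ler_pdivrMr ?expR_gt0// mulrC.
have := @nondecreasing_from0 R (fun s => expR s * f s x)
  (fun s => 2 * sin (pi * distr (f s) x) ^+ 2 * (expR s * f s x)).
rewrite expR0 mul1r f00; apply => //.
- move=> s s0; have ds := df s x s0.
  apply: is_derive_eq; rewrite /GRing.scale /=.
  by move: (sin _) (f s x) (expR s) => a b c; ring.
- move=> s s0; have [_ p0 _] := fD s (ltW s0).
  by apply: mulr_ge0; rewrite mulr_ge0 ?sqr_ge0 ?expR_ge0.
- rewrite -[X in _ --> X]mul1r -(@expR0 R).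
  apply: cvgM; last exact: flow_right0.
  exact: (is_derive_at_right (is_derive_expR 0)).
Qed.

Lemma flow_upper (t x : R) : 0 <= t -> f t x <= expR t * f0 x.
Proof.
have [f00 fD _ df] := fl.
move=> t0; rewrite mulrC -ler_pdivrMr ?expR_gt0// -expRN mulrC -lerN2.
have := @nondecreasing_from0 R (fun s => - (expR (- s) * f s x))
  (fun s => 2 * (1 - sin (pi * distr (f s) x) ^+ 2) * (expR (- s) * f s x)).
rewrite oppr0 expR0 mul1r f00; apply => //.
- move=> s s0; have ds := df s x s0.
  apply: is_derive_eq; rewrite /GRing.scale /=.
  by move: (sin _) (f s x) (expR (- s)) => a b c; ring.
- move=> s s0; have [_ p0 _] := fD s (ltW s0).
  by rewrite !mulr_ge0 ?expR_ge0// subr_ge0 -cos2Dsin2 lerDr sqr_ge0.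
- apply: cvgN; rewrite -[X in _ --> X]mul1r -(@expR0 R) -{2}oppr0.
  apply: cvgM; last exact: flow_right0.
  have d0 : is_derive (0 : R) 1 (fun s : R => expR (- s)) (- expR (- 0)).
    by apply: is_derive_eq; rewrite /GRing.scale /=; ring.
  exact: (is_derive_at_right d0).
Qed.

Lemma flow_gt0 (t x : R) : 0 <= t -> I x -> 0 < f t x.
Proof.
move=> t0 Ix; apply: lt_le_trans (flow_lower x t0).
by rewrite mulr_gt0 ?expR_gt0// f0_gt0.
Qed.

Lemma flow_off (t x : R) : 0 <= t -> ~ I x -> f t x = 0.
Proof.
move=> t0 nIx; have [_ fD _ _] := fl; have [_ p0 _] := fD t t0.
apply/eqP; rewrite eq_le p0 andbT; apply: le_trans (flow_upper x t0) _.
by rewrite f0_off// mulr0.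
Qed.

(** Both logarithms satisfy the flow equation, at ranks that differ by at
    most M e^{ls}. The coefficient is 4 pi-Lipschitz in the rank, and
    4 pi M e^{ls} is the derivative of 4 pi M e^{ls} / l. *)
Lemma flow_ln_gap (M l x t : R) : 0 <= M -> 0 < l -> I x ->
  (forall s, 0 <= s ->
     `|distr (f s) x - dilate s (distr f0 x)| <= M * expR (l * s)) ->
  0 <= t ->
  `|ln (f t x) - ln (dilated_density f0 t x)| <= 4 * pi * M / l * expR (l * t).
Proof.
move=> M0 l0 Ix gap t0; have [f00 fD _ df] := fl.
have u01 := distr_itv f0I Ix.
set u := distr f0 x in u01 gap *.
pose K := 4 * pi * M / l.
(* [h] vanishes at time 0, where the two densities agree *)
pose h s := ln (f s x) - ln (dilate_deriv s u) - ln (f0 x).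
pose dh s := 2 * sin (pi * distr (f s) x) ^+ 2 - 2 * sin (pi * dilate s u) ^+ 2.
have dhP (s : R) : 0 < s -> is_derive s 1 h (dh s).
  move=> s0; have fs0 := flow_gt0 (ltW s0) Ix; have ds := df s x s0.
  have dl := is_derive1_comp (g := f ^~ x) (is_derive1_ln fs0) ds.
  apply: is_derive_eq (is_deriveB (is_deriveB dl
    (is_derive_ln_dilate_deriv s u01)) (is_derive_cst (ln (f0 x)) s 1)) _.
  rewrite mulrC mulfK ?gt_eqF// /dh.
  by move: (sin _) (sin _) => a b; ring.
have h0 : h s @[s --> 0^'+] --> h 0.
  apply: cvgB; last exact: cvg_cst.
  apply: cvgB; last first.
    exact: (is_derive_at_right (is_derive_ln_dilate_deriv 0 u01)).
  rewrite f00; have := flow_right0 (x := x).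
  by apply: continuous_cvg; apply: continuous_ln; exact: f0_gt0.
have hh0 : h 0 = 0 by rewrite /h f00 dilate_deriv0 ln1 subr0 subrr.
have dE (s : R) : is_derive s 1 (fun s : R => K * expR (l * s))
    (K * (l * expR (l * s))).
  by apply: is_derive_eq; rewrite /GRing.scale /=; ring.
have E0 := is_derive_at_right (dE 0).
have Kl : K * l = 4 * pi * M by rewrite /K divfK// gt_eqF.
have K0 : 0 <= K by rewrite /K !mulr_ge0 ?pi_ge0// invr_ge0 ltW.
have bound (s : R) : 0 < s -> `|dh s| <= K * (l * expR (l * s)).
  move=> s0; apply: le_trans (sin_sqr_lipschitz _ _) _.
  rewrite mulrA Kl -[leRHS]mulrA ler_wpM2l ?mulr_ge0 ?pi_ge0//.
  exact: gap (ltW s0).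
have dm (s : R) : 0 < s -> is_derive s 1 (fun s => K * expR (l * s) - h s)
    (K * (l * expR (l * s)) - dh s).
  by move=> s0; exact: is_deriveB (dE s) (dhP s s0).
have dp (s : R) : 0 < s -> is_derive s 1 (fun s => K * expR (l * s) + h s)
    (K * (l * expR (l * s)) + dh s).
  by move=> s0; exact: is_deriveD (dE s) (dhP s s0).
have dm0 (s : R) : 0 < s -> 0 <= K * (l * expR (l * s)) - dh s.
  by move=> /bound; rewrite ler_norml subr_ge0 => /andP[].
have dp0 (s : R) : 0 < s -> 0 <= K * (l * expR (l * s)) + dh s.
  by move=> /bound; rewrite ler_norml -subr_ge0 opprK addrC => /andP[].
have cm : K * expR (l * s) - h s @[s --> 0^'+] --> K * expR (l * 0) - h 0.
  exact: cvgB E0 h0.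
have cp : K * expR (l * s) + h s @[s --> 0^'+] --> K * expR (l * 0) + h 0.
  exact: cvgD E0 h0.
have Hm := nondecreasing_from0 dm dm0 cm t0.
have Hp := nondecreasing_from0 dp dp0 cp t0.
have -> : ln (dilated_density f0 t x) = ln (dilate_deriv t u) + ln (f0 x).
  by rewrite /dilated_density lnM ?posrE ?f0_gt0 ?dilate_deriv_gt0// addrC.
rewrite opprD addrA -/(h t) -/K.
move: Hm Hp; rewrite /= hh0 mulr0 expR0 subr0 addr0 mulr1 => Hm Hp.
rewrite ler_norml lerNl -subr_ge0 opprK (le_trans K0 Hp)/=.
by rewrite -subr_ge0 (le_trans K0 Hm).
Qed.

(** The exponent 16 pi is chosen so that the constant of
    [flow_ln_gap] is M / 4; the densities f_t and [dilated_density f0 t] have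
    total mass at most 2, which leaves a factor 1/2. *)
Lemma flow_gap_contract (M : R) : 0 <= M ->
  (forall s x, 0 <= s -> I x ->
     `|distr (f s) x - dilate s (distr f0 x)| <= M * expR (16 * pi * s)) ->
  forall s x, 0 <= s -> I x ->
     `|distr (f s) x - dilate s (distr f0 x)| <= M / 2 * expR (16 * pi * s).
Proof.
move=> M0 gap t x t0 Ix; have [f00 fD _ df] := fl.
have l0 : 0 < 16 * pi :> R by rewrite mulr_gt0 ?pi_gt0.
pose c := M / 4 * expR (16 * pi * t).
have c0 : 0 <= c by rewrite mulr_ge0 ?expR_ge0// divr_ge0.
have ptw y : `|f t y - dilated_density f0 t y| <=
    c * (f t y + dilated_density f0 t y).
  have [Iy|nIy] := pselect (I y); last first.
    rewrite /dilated_density f0_off// flow_off// mul0r subrr addr0 mulr0.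
    by rewrite normr0.
  have gy : 0 < dilated_density f0 t y.
    by rewrite mulr_gt0 ?f0_gt0 ?dilate_deriv_gt0.
  apply: le_trans (normB_le_ln (flow_gt0 t0 Iy) gy) _.
  have s0 : 0 <= f t y + dilated_density f0 t y.
    by rewrite ltW// addr_gt0// flow_gt0.
  have E : 4 * pi * M / (16 * pi) = M / 4 :> R.
    have : pi != 0 :> R by rewrite gt_eqF ?pi_gt0.
    by move: (pi : R) => p p0; field.
  have := flow_ln_gap M0 l0 Iy (fun s s0 => gap s y s0 Iy) t0.
  by rewrite E => H; rewrite ler_wpM2r.
have if_ := density_integrable (fD t t0) (measurable_itv `]-oo, x]).
have ig := dilated_density_integrable f0I t0 (measurable_itv `]-oo, x]).
have iB : (@mu R).-integrable `]-oo, x]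
    (EFin \o (fun y => f t y - dilated_density f0 t y)).
  by rewrite (_ : _ \o _ = (EFin \o f t) \- (EFin \o dilated_density f0 t))%E//;
    exact: integrableB.
have iD : (@mu R).-integrable `]-oo, x]
    (EFin \o (fun y => f t y + dilated_density f0 t y)).
  by rewrite (_ : _ \o _ = (EFin \o f t) \+ (EFin \o dilated_density f0 t))%E//;
    exact: integrableD.
rewrite -(distr_dilated f0I t0 Ix) /distr -RintegralB//.
apply: le_trans (le_normr_Rintegral _ iB) _ => //.
have -> : M / 2 * expR (16 * pi * t) = c * 2.
  by rewrite /c; move: (expR _) => e; field.
have step : \int[mu]_(y in `]-oo, x]) `|f t y - dilated_density f0 t y| <=
    \int[mu]_(y in `]-oo, x]) (c * (f t y + dilated_density f0 t y)).
  apply: le_Rintegral => //.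
  - exact: (integrable_norm iB).
  - exact: (integrableZl _ _ iD).
apply: le_trans step _.
rewrite RintegralZl// ler_wpM2l// RintegralD//.
rewrite -[leRHS]/(1 + 1); apply: lerD.
  exact: (distr_le1 (fD t t0)).
rewrite -[X in X <= _]/(distr (dilated_density f0 t) x).
rewrite (distr_dilated f0I t0 Ix).
have := cauchy_cdf_itv (expR t * cauchy_quantile (distr f0 x)).
by rewrite in_itv/= => /andP[_ /ltW].
Qed.

(** The gap is at most 1 to begin with, and the contraction can be applied
    any number of times. *)
Lemma flow_distr (t x : R) : 0 <= t -> I x ->
  distr (f t) x = dilate t (distr f0 x).
Proof.
have [f00 fD _ df] := fl => t0 Ix.
have gap n : forall s y, 0 <= s -> I y ->
   `|distr (f s) y - dilate s (distr f0 y)| <= 2^-1 ^+ n * expR (16 * pi * s).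
  elim: n => [|n IHn] s y s0 Iy.
    rewrite expr0 mul1r; apply: (@le_trans _ _ 1).
      have := cauchy_cdf_itv (expR s * cauchy_quantile (distr f0 y)).
      rewrite in_itv/= -/(dilate s _) => /andP[].
      have := distr_ge0 (fD s s0) y; have := distr_le1 (fD s s0) y.
      move: (distr (f s) y) (dilate s _) => a b a1 a0 b0 b1.
      by rewrite ler_norml; apply/andP; split; lra.
    by rewrite -expR0 ler_expR mulr_ge0// mulr_ge0// pi_ge0.
  have e0 : 0 <= 2^-1 ^+ n :> R by rewrite exprn_ge0.
  have := flow_gap_contract e0 IHn s0 Iy.
  by rewrite exprSr.
apply/eqP; rewrite -subr_eq0 -normr_le0.
have cv : 2^-1 ^+ n * expR (16 * pi * t) @[n --> \oo] --> (0 : R).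
  rewrite -[X in _ --> X](mul0r (expR (16 * pi * t))).
  apply: cvgMl; apply: cvg_expr; rewrite ger0_norm// invf_lt1 ?ltr1n//.
apply: (cvgr_to_ge cv); apply: nearW => n; exact: gap.
Qed.

End flow_solution.

(** * Potential and curvature along the flow *)

Lemma D2plus_density_on (R : realType) (f0 : R -> R) : D2plus f0 ->
  exists I : set R, density_on I f0 /\
    jet3 I (distr f0) f0 f0^`()%classic f0^`(2)%classic.
Proof.
move=> [f0D [I [Io iI f0_gt0 f0_off f0_d2]]]; exists I.
have f0_cont x : I x -> {for x, continuous f0}.
  move=> /f0_d2[d _ _].
  by apply: differentiable_continuous; exact/derivable1_diffP.
split; first by split.
move=> x Ix; have [d1 d2 _] := f0_d2 x Ix; split.
- by apply: is_derive_distr; [exact: (density_integrable f0D)|exact: f0_cont].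
- by rewrite derive1E; exact: DeriveDef d1 erefl.
- by rewrite derive1nS derive1E; exact: DeriveDef d2 erefl.
Qed.

Section potential.
Variables (R : realType) (f0 : R -> R) (I : set R) (f : R -> R -> R).
Hypothesis f0I : density_on I f0.
Hypothesis f0J : jet3 I (distr f0) f0 f0^`()%classic f0^`(2)%classic.
Hypothesis fl : canonical_flow f0 f.

Let Io : open I. Proof. by case: f0I => _ []. Qed.
Let iI : is_interval I. Proof. by case: f0I => _ []. Qed.
Let f0_neq0 x : I x -> f0 x != 0.
Proof. by case: f0I => _ _ f0_gt0 _ _ /f0_gt0 /lt0r_neq0. Qed.
Let o01 : open (`]0, 1[%classic : set R). Proof. by []. Qed.

(** The gap of the distribution functions being 0, that of the
    logarithms is 0 as well. *)
Lemma flow_density (t x : R) : 0 <= t -> I x ->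
  f t x = dilated_density f0 t x.
Proof.
move=> t0 Ix.
have gap s : 0 <= s ->
    `|distr (f s) x - dilate s (distr f0 x)| <= 0 * expR (1 * s).
  by move=> s0; rewrite (flow_distr f0I fl s0 Ix) subrr normr0 mul0r.
have := flow_ln_gap f0I fl (lexx 0) ltr01 Ix gap t0.
rewrite mulr0 !mul0r normr_le0 subr_eq0 => /eqP/ln_inj; apply.
  by rewrite posrE (flow_gt0 f0I fl).
have [_ _ f0_gt0 _ _] := f0I.
by rewrite posrE mulr_gt0 ?f0_gt0 ?dilate_deriv_gt0.
Qed.

Lemma quantile_flow (t z : R) : 0 <= t -> z \in `]0, 1[ ->
  quantile (f t) z = quantile f0 (dilate (- t) z).
Proof.
move=> t0 z01; have [f00 fD _ _] := fl.
have u01 := cauchy_cdf_itv (expR (- t) * cauchy_quantile z).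
have [Fq Iq] := distr_quantile f0I u01.
have Ftq : distr (f t) (quantile f0 (dilate (- t) z)) = z.
  by rewrite (flow_distr f0I fl)// Fq dilateNK.
have Fq' : distr (f t) (quantile (f t) z) = z.
  apply: (@xgetPex _ 0 [set x | distr (f t) x = z]).
  by exists (quantile f0 (dilate (- t) z)).
have Iq' : I (quantile (f t) z).
  apply: contrapT => nI; move: z01; rewrite -Fq'.
  by have [->|->] := distr_off (fD t t0) iI (fun y => flow_off f0I fl t0) nI;
    rewrite in_itv/= ltxx ?andbF.
apply: (distr_inj f0I) => //; rewrite Fq.
rewrite -[LHS](dilateK t) -?(flow_distr f0I fl t0 Iq') ?Fq'//.
exact: (distr_itv f0I).
Qed.

Lemma quantile_distr_flow (t x : R) : 0 <= t -> I x ->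
  quantile (f t) (distr (f t) x) = x.
Proof.
move=> t0 Ix; have u01 := distr_itv f0I Ix.
rewrite (flow_distr f0I fl t0 Ix) quantile_flow//; last exact: cauchy_cdf_itv.
rewrite dilateK//; apply: (distr_inj f0I) => //.
  by case: (distr_quantile f0I u01).
by case: (distr_quantile f0I u01).
Qed.

Lemma distr_quantile_flow (t z : R) : 0 <= t -> z \in `]0, 1[ ->
  distr (f t) (quantile (f t) z) = z /\ I (quantile (f t) z).
Proof.
move=> t0 z01; rewrite quantile_flow//.
have [Fq Iq] := distr_quantile f0I
  (cauchy_cdf_itv (expR (- t) * cauchy_quantile z)).
by rewrite (flow_distr f0I fl t0 Iq) Fq dilateNK.
Qed.

Lemma jet3_quantile : exists q1 q2 q3 : R -> R,
  jet3 `]0, 1[%classic (quantile f0) q1 q2 q3 /\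
  forall z, z \in `]0, 1[ -> q1 z != 0.
Proof.
have [f00 _ _ _] := fl.
have QE z : `]0, 1[%classic z -> I (quantile f0 z).
  by move=> z01; case: (distr_quantile f0I z01).
have FK z : `]0, 1[%classic z -> distr f0 (quantile f0 z) = z.
  by move=> z01; case: (distr_quantile f0I z01).
have QK x : I x -> quantile f0 (distr f0 x) = x.
  by move=> Ix; rewrite -f00 quantile_distr_flow.
have J := jet3_inverse o01 Io QE FK QK f0J f0_neq0.
do 3 eexists; split; first exact: J.
by move=> z /QE Iq; rewrite invr_eq0 f0_neq0.
Qed.

(** Chain rule for Q_t = Q_0 o phi_{-t}. *)
Lemma hill_potential_flow (t z : R) : 0 <= t -> z \in `]0, 1[ ->
  hill_potential (f t) z - 2 * pi ^+ 2 =
  dilate_deriv (- t) z ^+ 2 *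
    (hill_potential f0 (dilate (- t) z) - 2 * pi ^+ 2).
Proof.
move=> t0 z01; have [q1 [q2 [q3 [QJ q10]]]] := jet3_quantile.
have [k2 [k3 kJ]] := jet3_dilate (- t).
have k01 v : `]0, 1[%classic v -> `]0, 1[%classic (dilate (- t) v).
  by move=> _; exact: cauchy_cdf_itv.
have QE v : `]0, 1[%classic v ->
    (quantile f0 \o dilate (- t)) v = quantile (f t) v.
  by move=> v01; rewrite quantile_flow.
rewrite /hill_potential (schwarzian_eq_on o01 QE (jet3_comp k01 kJ QJ) z01).
rewrite (schwarzian_comp o01 o01 k01 kJ QJ z01); last 2 first.
- by rewrite gt_eqF// dilate_deriv_gt0.
- by apply: q10; exact: cauchy_cdf_itv.
rewrite schwarzian_dilate//.
by move: (schwarzian _ _) (dilate_deriv _ _) (pi : R) => a b p; ring.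
Qed.

Lemma projective_curvature_flow (t z : R) : 0 <= t -> z \in `]0, 1[ ->
  projective_curvature (f t) (quantile (f t) z) = - hill_potential (f t) z.
Proof.
move=> t0 z01.
have [k2 [k3 kJ]] := jet3_dilate t.
have F01 x : I x -> `]0, 1[%classic (distr f0 x).
  by move=> Ix; exact: (distr_itv f0I).
have FtE x : I x -> (dilate t \o distr f0) x = distr (f t) x.
  by move=> Ix; rewrite (flow_distr f0I fl).
have ftE x : I x -> dilate_deriv t (distr f0 x) * f0 x = f t x.
  by move=> Ix; rewrite flow_density// /dilated_density mulrC.
have FtJ := jet3_eq_on Io FtE ftE (jet3_comp F01 f0J kJ).
apply: (schwarzian_inverse o01 Io _ _ _ FtJ _ z01).
- by move=> v v01; case: (distr_quantile_flow t0 v01).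
- by move=> v v01; case: (distr_quantile_flow t0 v01).
- by move=> x Ix; exact: quantile_distr_flow.
- by move=> x Ix; rewrite gt_eqF// (flow_gt0 f0I fl).
Qed.

End potential.

(** * Rates and profile on compact sets of ranks *)

Lemma cvg_uniform_nearP (R : realType) (K : set R) (W : R -> R -> R)
    (p : R -> R) :
  {uniform K, W @ +oo --> p} <->
  (forall e : R, 0 < e ->
     \forall t \near +oo, forall z, K z -> `|p z - W t z| < e).
Proof.
split=> [H e e0|H P /uniform_nbhs [E []]].
  apply: (H [set h | forall z, K z -> `|p z - h z| < e]).
  apply/uniform_nbhs; exists [set xy : R * R | ball xy.1 e xy.2].
  by split; [exact: (entourage_ball R (PosNum e0))|].
rewrite -entourage_ballE => -[e /= e0 eE] EP.
apply: filterS (H e e0) => t Ht; apply: EP => z Kz.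
by apply: eE => /=; exact: Ht.
Qed.

Lemma near_expRN2_lt (R : realType) (C e : R) : 0 < e ->
  \forall t \near +oo, expR (- (2 * t)) * C < e.
Proof.
move=> e0.
have H : expR (- t) * expR (- t) * C @[t --> +oo] --> (0 * 0 * C : R).
  by apply: cvgMl; apply: cvgM; exact: cvgr_expR.
have : \forall t \near +oo, expR (- t) * expR (- t) * C < e.
  by apply: (cvgr_lt _ H); rewrite !mul0r.
by apply: filterS => t; rewrite -expRD mulr_natl mulr2n opprD.
Qed.

(** Once e^{2t} (W - w) converges uniformly to a bounded profile that stays
    above |d| in absolute value, every clause on the rate follows. *)
Lemma profile_relaxes (R : realType) (W : R -> R -> R) (w d : R)
    (p : R -> R) :
  (forall K : set R, compact K -> K `<=` `]0, 1[ ->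
     exists B, forall z, K z -> `|p z| <= B) ->
  (forall z, `|d| <= `|p z|) -> (d = 0 -> forall z, p z = 0) ->
  has_profile W w p -> relaxes W w d.
Proof.
move=> pB dp p0 Wp K cK K01; have /cvg_uniform_nearP H := Wp K cK K01.
have [B HB] := pB K cK K01.
have WE t z : W t z - w = expR (- (2 * t)) * (expR (2 * t) * (W t z - w)).
  by rewrite mulrA expRN mulVf ?mul1r// gt_eqF ?expR_gt0.
have upper : \forall t \near +oo, forall z, K z ->
    `|W t z - w| <= expR (- (2 * t)) * (`|B| + 1).
  apply: filterS (H 1 ltr01) => t Ht z Kz.
  rewrite WE normrM (ger0_norm (expR_ge0 _)) ler_wpM2l ?expR_ge0//.
  have := Ht z Kz; have := HB z Kz; have := ler_norm B.
  have := ler_distD (p z) (expR (2 * t) * (W t z - w)) 0; rewrite !subr0.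
  rewrite (distrC (_ * _)); move: (`|p z - _|) (`|p z|) (`|B|) (`|_ * _|).
  by move=> a1 a2 a3 a4; lra.
split.
- apply/cvg_uniform_nearP => e e0.
  apply: filterS2 upper (near_expRN2_lt (`|B| + 1) e0) => t Ht te z Kz.
  by rewrite distrC (le_lt_trans (Ht z Kz)).
- move=> d0; exists (`|d| / 2), (`|B| + 1).
  have d2 : 0 < `|d| / 2 by rewrite divr_gt0 ?normr_gt0.
  have B1 : 0 < `|B| + 1 by apply: ltr_wpDl.
  split; [exact: d2|exact: B1|].
  apply: filterS2 upper (H _ d2) => t Ht Hd z Kz.
  rewrite (mulrC (`|B| + 1)) Ht// andbT mulrC.
  rewrite WE normrM (ger0_norm (expR_ge0 _)) ler_wpM2l ?expR_ge0//.
  have := Hd z Kz; have := dp z.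
  have := ler_distD (expR (2 * t) * (W t z - w)) (p z) 0; rewrite !subr0.
  move: (`|p z - _|) (`|p z|) (`|d|) (`|_ * _|).
  by move=> a1 a2 a3 a4; lra.
- move=> d0; apply/cvg_uniform_nearP => e /H; apply: filterS => t Ht z Kz.
  by rewrite -(p0 d0 z); exact: Ht.
Qed.

Lemma compact_cauchy_quantile (R : realType) (K : set R) :
  compact K -> K `<=` `]0, 1[%classic ->
  exists M : R, 0 <= M /\ forall z, K z -> `|cauchy_quantile z| <= M.
Proof.
move=> cK K01.
have cV : {within K, continuous (@cauchy_quantile R)}.
  apply: continuous_in_subspaceT => z; rewrite inE => /K01 z01.
  have [d _ _] := jet3_cauchy_quantile z01.
  by apply: differentiable_continuous; apply/derivable1_diffP; case: d.
have [M [Mr HM]] := compact_bounded (continuous_compact cV cK).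
exists (`|M| + 1); split; first by rewrite addr_ge0.
move=> z Kz; apply: HM; last by exists z.
by rewrite (le_lt_trans (ler_norm M))// ltrDl.
Qed.

(** The largest distance to 1/2 of the ranks phi_{-t}(z) with
    |V(z)| <= M. *)
Definition rank_radius (R : realType) (M t : R) : R :=
  atan (expR (- t) * M) / pi.

Lemma rank_radius_itv (R : realType) (M t : R) : 0 <= M ->
  0 <= rank_radius M t < 2^-1.
Proof.
move=> M0; rewrite divr_ge0 ?pi_ge0//=; last first.
  by rewrite -(atan0 R) le_atan// mulr_ge0 ?expR_ge0.
rewrite ltr_pdivrMr ?pi_gt0// [ltRHS]mulrC.
exact: atan_ltpi2.
Qed.

Lemma cvg_rank_radius (R : realType) (M : R) :
  rank_radius M t @[t --> +oo] --> (0 : R).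
Proof.
rewrite -[X in _ --> X](mul0r pi^-1); apply: cvgMl.
rewrite -(atan0 R); apply: continuous_cvg; first exact: continuous_atan.
by rewrite -[X in _ --> X](mul0r M); apply: cvgMl; exact: cvgr_expR.
Qed.

Lemma dilate_rank_radius (R : realType) (M t z : R) :
  `|cauchy_quantile z| <= M -> `|dilate (- t) z - 2^-1| <= rank_radius M t.
Proof.
rewrite !ler_norml => /andP[h1 h2].
have p0 : 0 < pi^-1 :> R by rewrite invr_gt0 pi_gt0.
rewrite /dilate /cauchy_cdf addrAC subrr add0r /rank_radius.
rewrite -mulNr -atanN !ler_pM2r// -mulrN.
by rewrite !le_atan// ler_pM2l ?expR_gt0.
Qed.

(** Bernoulli: 1 - (1 + y)^{-2} <= 2 y. *)
Lemma damped_gap (R : realFieldType) (y d x : R) : 0 <= y ->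
  `|d - x / (1 + y) ^+ 2| <= 2 * y * `|d| + `|d - x|.
Proof.
move=> y0; have s0 : 0 < (1 + y) ^+ 2 by rewrite exprn_gt0// ltr_pwDl.
pose q := ((1 + y) ^+ 2)^-1.
have q0 : 0 <= q by rewrite invr_ge0 ltW.
have q1 : q <= 1 by rewrite invf_le1// exprn_ege1// lerDl.
have qy : 1 - q <= 2 * y.
  rewrite lerBlDl -lerBlDr /q -[leRHS]mul1r ler_pdivlMr//.
  have y2 : 0 <= y ^+ 2 by rewrite sqr_ge0.
  have y3 : 0 <= y ^+ 3 by rewrite exprn_ge0.
  by nra.
rewrite -/q (_ : d - x * q = (1 - q) * d + q * (d - x)); last by ring.
apply: le_trans (ler_normD _ _) _; rewrite !normrM.
rewrite (ger0_norm q0) (ger0_norm (_ : 0 <= 1 - q)) ?subr_ge0//.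
by apply: lerD; [rewrite ler_wpM2r|rewrite ler_piMl].
Qed.

(** With a = e^{-2t}, the rescaled potential is
    (1 + V^2)^2 x / (1 + a V^2)^2 where x = U_0(phi_{-t}(z)) - w. On a compact
    set V is bounded, so the denominator tends to 1, and phi_{-t}(z) tends to
    1/2, uniformly in both cases. *)
Lemma rank_profile (R : realType) (U0 : R -> R) (U : R -> R -> R) (w : R) :
  {for 2^-1, continuous U0} ->
  (forall t z : R, 0 <= t -> z \in `]0, 1[ ->
     U t z - w = dilate_deriv (- t) z ^+ 2 * (U0 (dilate (- t) z) - w)) ->
  has_profile U w (fun z => (1 + cauchy_quantile z ^+ 2) ^+ 2 * (U0 2^-1 - w)).
Proof.
move=> U0c UE K cK K01; apply/cvg_uniform_nearP => e e0.
have [M [M0 HM]] := compact_cauchy_quantile cK K01.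
set d := U0 2^-1 - w.
pose c := (1 + M ^+ 2) ^+ 2.
have c0 : 0 < c by rewrite exprn_gt0// ltr_pwDl ?sqr_ge0.
have ec0 : 0 < e / 2 / c by rewrite !divr_gt0.
have /cvgrPdist_lt/(_ _ ec0)[r /= r0 Ur] := U0c.
have rad : \forall t \near +oo, rank_radius M t < r.
  by apply: (cvgr_lt _ (cvg_rank_radius M)).
have e20 : 0 < e / 2 by rewrite divr_gt0.
have small := near_expRN2_lt (c * (2 * M ^+ 2 * `|d|)) e20.
have pos : \forall t \near +oo, (0 : R) <= t by exact: nbhs_pinfty_ge.
near=> t => z Kz.
have t0 : 0 <= t by near: t.
have z01 := K01 z Kz.
have V2 : cauchy_quantile z ^+ 2 <= M ^+ 2.
  by rewrite -real_normK ?num_real// ler_sqr ?nnegrE ?HM.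
rewrite UE// mulrA expR_dilate_derivN//.
set v := cauchy_quantile z ^+ 2 in V2 *.
have v0 : 0 <= v by rewrite sqr_ge0.
set a := expR (- (2 * t)); set x := U0 _ - w.
have a0 : 0 <= a by rewrite expR_ge0.
rewrite -mulrA (mulrC (_^-1)) -mulrBr normrM ger0_norm ?sqr_ge0//.
have xd : `|d - x| < e / 2 / c.
  rewrite /d /x opprB addrA subrK; apply: Ur => /=.
  rewrite distrC; apply: le_lt_trans (dilate_rank_radius _ (HM z Kz)) _.
  by near: t.
have vc : (1 + v) ^+ 2 <= c.
  by rewrite ler_sqr ?nnegrE ?addr_ge0 ?sqr_ge0// lerD2l.
have H1 := damped_gap d x (mulr_ge0 a0 v0).
have H2 : 2 * (a * v) * `|d| <= a * (2 * M ^+ 2 * `|d|).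
  have -> : 2 * (a * v) * `|d| = a * (2 * v * `|d|) by ring.
  by rewrite ler_wpM2l// ler_wpM2r// ler_wpM2l.
apply: (@le_lt_trans _ _ (c * (a * (2 * M ^+ 2 * `|d|) + `|d - x|))).
  apply: ler_pM => //; first exact: sqr_ge0.
  by apply: le_trans H1 _; rewrite lerD2r.
rewrite mulrDr [ltRHS](splitr e); apply: ltrD.
  by rewrite mulrCA /a; near: t.
by rewrite mulrC -ltr_pdivlMr.
Unshelve. all: by end_near. Qed.

Lemma has_profileN (R : realType) (U W : R -> R -> R) (w : R) (p : R -> R) :
  (forall t z : R, 0 <= t -> z \in `]0, 1[ -> W t z = - U t z) ->
  has_profile U w p -> has_profile W (- w) (fun z => - p z).
Proof.
move=> WU Up K cK K01; apply/cvg_uniform_nearP => e e0.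
have /cvg_uniform_nearP/(_ e e0) := Up K cK K01.
apply: filterS2 (nbhs_pinfty_ge (num_real 0)) => t t0 Ht z Kz.
rewrite WU//; last exact: K01.
rewrite (_ : - p z - _ = - (p z - expR (2 * t) * (U t z - w))); last by ring.
by rewrite normrN; exact: Ht.
Qed.

Lemma rank_profile_bounded (R : realType) (d : R) (K : set R) :
  compact K -> K `<=` `]0, 1[%classic ->
  exists B, forall z, K z -> `|(1 + cauchy_quantile z ^+ 2) ^+ 2 * d| <= B.
Proof.
move=> cK K01; have [M [M0 HM]] := compact_cauchy_quantile cK K01.
exists ((1 + M ^+ 2) ^+ 2 * `|d|) => z Kz.
rewrite normrM ler_wpM2r// ger0_norm ?sqr_ge0//.
rewrite ler_sqr ?nnegrE ?addr_ge0 ?sqr_ge0// lerD2l.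
by rewrite -real_normK ?num_real// ler_sqr ?nnegrE ?HM.
Qed.

Lemma rank_profile_ge (R : realType) (d z : R) :
  `|d| <= `|(1 + cauchy_quantile z ^+ 2) ^+ 2 * d|.
Proof.
rewrite normrM ler_peMl// ger0_norm ?sqr_ge0//.
by rewrite exprn_ege1// lerDl sqr_ge0.
Qed.

Theorem theorem24 (R : realType) (f0 : R -> R) (f : R -> R -> R)
    (f0_D2plus : D2plus f0)
    (U0_cont : {in `]0, 1[, continuous (hill_potential f0)})
    (f_flow : canonical_flow f0 f) :
  let U0 := hill_potential f0 in
  let U t := hill_potential (f t) in
  let rho t z := projective_curvature (f t) (quantile (f t) z) in
  let V := @cauchy_quantile R in
  let d := U0 2^-1 - 2 * pi ^+ 2 in
  [/\ (forall K : set R, compact K -> K `<=` `]0, 1[ ->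
        exists delta : R -> R,
          [/\ forall t : R, 0 <= t -> 0 <= delta t < 2^-1,
              delta t @[t --> +oo] --> 0
            & forall t : R, 0 <= t ->
              (ereal_sup [set `|U t z - 2 * pi ^+ 2|%:E | z in K] <=
               (expR (- (2 * t)))%:E *
               ereal_sup [set ((1 + V z ^+ 2) ^+ 2)%:E | z in K] *
               ereal_sup [set `|U0 s - 2 * pi ^+ 2|%:E
                         | s in [set s | (`|s - 2^-1| <= delta t)%R]])%E]),
      relaxes U (2 * pi ^+ 2) d,
      {for 2^-1, continuous U0} ->
        has_profile U (2 * pi ^+ 2) (fun z => (1 + V z ^+ 2) ^+ 2 * d),
      relaxes rho (- (2 * pi ^+ 2)) d
    & {for 2^-1, continuous U0} ->
        has_profile rho (- (2 * pi ^+ 2))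
          (fun z => - ((1 + V z ^+ 2) ^+ 2 * d)) ].
Proof.
move=> U0 U rho V d; have [I [f0I f0J]] := D2plus_density_on f0_D2plus.
have half01 : (2^-1 : R) \in `]0, 1[.
  by rewrite in_itv/= invr_gt0 ltr0n/= invf_lt1 ?ltr1n.
have U0c : {for 2^-1, continuous U0} by exact: U0_cont.
have UE t z (t0 : 0 <= t) (z01 : z \in `]0, 1[) :=
  hill_potential_flow f0I f0J f_flow t0 z01.
have UP := rank_profile U0c UE.
have rhoP : has_profile rho (- (2 * pi ^+ 2))
    (fun z => - ((1 + V z ^+ 2) ^+ 2 * d)).
  apply: has_profileN UP => t z t0 z01.
  exact: (projective_curvature_flow f0I f0J f_flow t0 z01).
split=> //.
- move=> K cK K01; have [M [M0 HM]] := compact_cauchy_quantile cK K01.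
  exists (rank_radius M); split; [|exact: cvg_rank_radius|].
    by move=> t _; exact: rank_radius_itv.
  move=> t t0; apply: ge_ereal_sup => _ [z Kz <-].
  have z01 := K01 z Kz.
  rewrite UE// normrM ger0_norm ?sqr_ge0// EFinM.
  apply: lee_pmul; rewrite ?lee_fin ?sqr_ge0//.
    apply: (@le_trans _ _ (expR (- (2 * t)) * (1 + V z ^+ 2) ^+ 2)%:E).
      by rewrite lee_fin; exact: dilate_derivN_le.
    rewrite EFinM lee_wpmul2l ?lee_fin ?expR_ge0//.
    by apply: ereal_sup_ubound; exists z.
  apply: ereal_sup_ubound; exists (dilate (- t) z) => //=.
  exact: dilate_rank_radius (HM z Kz).
- apply: profile_relaxes UP.
  + by move=> K cK K01; exact: rank_profile_bounded.
  + by move=> z; exact: rank_profile_ge.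
  + by move=> d0 z; rewrite -/d d0 mulr0.
- apply: profile_relaxes rhoP.
  + move=> K cK K01; have [B HB] := rank_profile_bounded d cK K01.
    by exists B => z Kz; rewrite normrN; exact: HB.
  + by move=> z; rewrite normrN; exact: rank_profile_ge.
  + by move=> d0 z; rewrite d0 mulr0 oppr0.
Qed.
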